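(* Let $\mathcal X\subseteq\mathbb R^d$ be convex and compact and let $F:\mathcal X\to\mathbb R^d$. The Minty condition holds for $\mathrm{VI}(\mathcal X,F)$ if and only if there is no $\epsilon$-expected VI solution to $\mathrm{VI}(\mathcal X,F)$ with $\epsilon<0$.
   Context: The Minty condition for $\mathrm{VI}(\mathcal X,F)$: there exists $x\in\mathcal X$ with $\langle F(x'),x'-x\rangle\ge0$ for all $x'\in\mathcal X$. For $\epsilon\in\mathbb R$ (possibly negative), an $\epsilon$-expected VI solution is a probability distribution $\mu\in\Delta(\mathcal X)$ over $\mathcal X$ such that $\mathbb E_{x\sim\mu}\langle F(x),x'-x\rangle\ge-\epsilon$ for all $x'\in\mathcal X$. Here $\Delta(\mathcal X)$ is the set of probability distributions on $\mathcal X$ for which the expectation is well defined (it contains all finitely supported ones); the paper's standing assumption is that $F$ is Lipschitz continuous and bounded, under which this is all Borel probability distributions. *)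

(* Defs.v *)
From HB Require Import structures.
From mathcomp Require Import all_boot all_order all_algebra.
From mathcomp Require Import all_classical all_reals all_analysis.
From mathcomp Require Import measurable_realfun.

Set Implicit Arguments.
Unset Strict Implicit.
Unset Printing Implicit Defensive.

Import Order.TTheory GRing.Theory Num.Theory.
Import numFieldNormedType.Exports.

Local Open Scope classical_set_scope.
Local Open Scope ring_scope.

(* R^d with its Borel sigma-algebra. *)
Definition borel_rV (R : realType) (d : nat) :=
  g_sigma_algebraType (@open 'rV[R]_d).

Definition dotv (R : realType) (d : nat) (u v : 'rV[R]_d) : R :=
  \sum_(i < d) u 0 i * v 0 i.

(* A map X -> R^d is represented by a total map F : R^d -> R^d of which only
   the values on X are ever used. *)

Definition minty (R : realType) (d : nat) (X : set 'rV[R]_d)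
    (F : 'rV[R]_d -> 'rV[R]_d) : Prop :=
  exists2 x, X x & forall x', X x' -> 0 <= dotv (F x') (x' - x).

(* Integrability of f on D for the completion of mu: f agrees almost everywhere
   with a measurable integrable function.  The completion is needed for a
   finitely supported mu to integrate every f, measurable or not
   ([finite_support_has_expectation]).  The library integral of f is then that
   of g ([integral_version]). *)
Definition has_expectation (dp : measure_display) (T : measurableType dp)
    (R : realType) (mu : probability T R) (D : set T) (f : T -> R) : Prop :=
  exists2 g : T -> R, mu.-integrable D (EFin \o g) & ae_eq mu D f g.

Definition Delta (R : realType) (d : nat) (X : set 'rV[R]_d)
    (F : 'rV[R]_d -> 'rV[R]_d) : set (probability (borel_rV R d) R) :=
  [set mu : probability (borel_rV R d) R | mu X = 1%E /\
    forall x', X x' -> has_expectation mu X (fun x => dotv (F x) (x' - x))].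

Definition expected_VI_solution (R : realType) (d : nat) (X : set 'rV[R]_d)
    (F : 'rV[R]_d -> 'rV[R]_d) (eps : R)
    (mu : probability (borel_rV R d) R) : Prop :=
  Delta X F mu /\
  forall x', X x' ->
    ((- eps)%:E <= \int[mu]_(x in X) (dotv (F x) (x' - x))%:E)%E.

Import HBNNSimple.

Lemma ge0_integral_version (dp : measure_display) (T : measurableType dp)
    (R : realType) (mu : {measure set T -> \bar R}) (D : set T)
    (f g : T -> \bar R) (mD : measurable D) (mg : measurable_fun D g)
    (f0 : forall x, (0 <= f x)%E) (g0 : forall x, (0 <= g x)%E)
    (fg : ae_eq mu D f g) :
  (\int[mu]_(x in D) f x = \int[mu]_(x in D) g x)%E.
Proof.
have [N [mN N0 sN]] := fg.
have fgN x : D x -> ~ N x -> f x = g x.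
  by move=> Dx Nx; apply: contrapT => h; apply: Nx; apply: sN => /= /(_ Dx).
have mgD : measurable_fun setT (g \_ D) by exact: (measurable_restrictT _ mD).1 mg.
have gD0 x : (0 <= (g \_ D) x)%E by rewrite patchE; case: ifPn.
have fD0 x : (0 <= (f \_ D) x)%E by rewrite patchE; case: ifPn.
rewrite integral_mkcond [RHS]integral_mkcond; apply/eqP; rewrite eq_le.
apply/andP; split.
  rewrite ge0_integralTE//; apply: ge_ereal_sup => _ [h hf <-].
  rewrite -integralT_nnsfun; apply: ae_ge0_le_integral => //.
  - by move=> x _; rewrite lee_fin.
  - exact/measurable_EFinP.
  - exists N; split => // x /= hx; apply: contrapT => Nx; apply: hx => _.
    apply: (le_trans (hf x)); rewrite !patchE; case: ifPn => // /set_mem Dx.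
    by rewrite fgN.
rewrite [leLHS]ge0_integralTE//; apply: ge_ereal_sup => _ [h hg <-].
rewrite -integralT_nnsfun.
pose h' : {nnsfun T >-> R} := proj_nnsfun h (measurableC mN).
have -> : (\int[mu]_x (h x)%:E = \int[mu]_x (h' x)%:E)%E.
  apply: ae_eq_integral => //; [exact/measurable_EFinP|exact/measurable_EFinP|].
  exists N; split => // x /= hx; apply: contrapT => Nx; apply: hx => _.
  by rewrite /h' /= /mindic /= indicE mem_set// mulr1.
rewrite [leRHS]ge0_integralTE// integralT_nnsfun.
apply: ereal_sup_ubound; exists h' => // x.
rewrite /h' /= /mindic /= indicE; have [/set_mem Nx|/negP Nx] := boolP (x \in ~` N).
  rewrite mulr1; apply: (le_trans (hg x)); rewrite !patchE.
  by case: ifPn => // /set_mem Dx; rewrite fgN.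
by rewrite mulr0.
Qed.

Lemma integral_version (dp : measure_display) (T : measurableType dp)
    (R : realType) (mu : probability T R) (D : set T) (f g : T -> R)
    (mD : measurable D) (ig : mu.-integrable D (EFin \o g))
    (fg : ae_eq mu D f g) :
  (\int[mu]_(x in D) (f x)%:E = \int[mu]_(x in D) (g x)%:E)%E.
Proof.
have mg : measurable_fun D (EFin \o g) by case/integrableP: ig.
rewrite integralE [RHS]integralE.
have fg' : ae_eq mu D (EFin \o f) (EFin \o g) by exact: ae_eq_comp fg.
have [fp fn] := (ae_eq_funeposneg mu D (EFin \o f) (EFin \o g)).1 fg'.
congr (_ - _)%E; apply: ge0_integral_version => //.
- exact: measurable_funepos.
- exact: measurable_funeneg.
Qed.

Lemma compact_measurable_rV (R : realType) d (X : set 'rV[R]_d) : compact X ->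
  measurable (X : set (borel_rV R d)).
Proof.
move=> cX; have cl : closed X.
  apply: compact_closed => //; exact: norm_hausdorff.
rewrite -(setCK X); apply: measurableC.
by apply: sub_sigma_algebra; exact: closed_openC.
Qed.

Lemma continuous_has_expectation (R : realType) d (X : set 'rV[R]_d)
  (mu : probability (borel_rV R d) R) (f : 'rV[R]_d -> R) : compact X ->
  {within X, continuous f} -> has_expectation mu X f.
Proof.
move=> cX cf; exists f; last exact: ae_eq_refl.
have mX := compact_measurable_rV cX.
have mf : measurable_fun (X : set (borel_rV R d)) (f : borel_rV R d -> R).
  apply: (measurability _ (RGenOpens.measurableE R)) => _ [_ [a [b ->] <-]].
  have oI : open `]a, b[%classic by exact: interval_open.
  have := (continuousP (f : subspace X -> R)).1 cf _ oI.
  rewrite open_subspaceP => -[V oV VE].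
  have -> : X `&` f @^-1` `]a, b[ = X `&` V by rewrite setIC [RHS]setIC VE.
  by apply: measurableI => //; exact: sub_sigma_algebra.
have [M [_ hM]] : bounded_set (f @` X).
  by apply: compact_bounded; exact: continuous_compact.
apply: (@measurable_bounded_integrable _ (borel_rV R d) R mu f X mX) => //.
  by apply: (le_lt_trans (probability_le1 mu mX)); rewrite ltry.
by exists M; split; [exact: num_real|] => r /hM h x Xx; apply: h; exists x.
Qed.

Lemma finite_support_has_expectation (R : realType) d (X : set 'rV[R]_d)
  (mu : probability (borel_rV R d) R) (f : 'rV[R]_d -> R) (A : set 'rV[R]_d) :
  measurable (X : set (borel_rV R d)) -> finite_set A -> mu A = 1%E ->
  has_expectation mu X f.
Proof.
move=> mX fA mA1.
have mA (B : set 'rV[R]_d) : B `<=` A -> measurable (B : set (borel_rV R d)).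
  move=> BA; apply: compact_measurable_rV.
  exact: finite_compact (sub_finite_set BA fA).
exists ((f : borel_rV R d -> R) \_ A).
  apply: (@integrableS _ (borel_rV R d) R mu setT X _ measurableT mX) => //.
  apply: (@measurable_bounded_integrable _ (borel_rV R d) R mu _ setT measurableT).
  - by apply: (le_lt_trans (probability_le1 mu measurableT)); rewrite ltry.
  - have mAA : measurable (A : set (borel_rV R d)) by exact: mA.
    have mfA : measurable_fun (A : set (borel_rV R d)) (f : borel_rV R d -> R).
      by move=> _ B mB; apply: mA => x [].
    exact: (measurable_restrictT _ mAA).1 mfA.
  - have [M [_ hM]] : bounded_set (f @` A).
      by apply: compact_bounded; exact: finite_compact (finite_image _ fA).
    exists (Num.max M 0); split; [exact: num_real|] => r.
    rewrite gt_max => /andP[/hM h r0] x _ /=; rewrite patchE; case: ifPn.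
      by move=> /set_mem Ax; apply: h; exists x.
    by rewrite normr0 ltW.
exists (~` A); split.
- exact: measurableC (mA A (@subset_refl _ A)).
- apply: etrans (probability_setC mu (mA A (@subset_refl _ A))) _.
  by rewrite mA1 subee.
- by move=> x /= h Ax; apply: h => _; rewrite patchE mem_set.
Qed.

(* Main.v *)
(* If the Minty condition fails, the open half-spaces
   { x | <F(y), x - y> > 0 }, y in X, cover X; let y_0, ..., y_(n-1) index a
   finite subcover.  The maximum over i of the affine functions
   g_i(x) = <F(y_i), x - y_i> is positive on X, so by a minimax argument some
   convex combination of the g_i, with weights w_i, is bounded below on X by a
   constant c > 0, and the measure sum_i w_i delta_(y_i) is a (-c)-expected
   solution.  Conversely, a Minty point makes the defining integral of any
   expected solution nonpositive. *)
From HB Require Import structures.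
Require Import Defs.
From mathcomp Require Import all_boot all_order all_algebra finmap.
From mathcomp Require Import all_classical all_reals all_analysis.
From mathcomp Require Import measurable_realfun ring lra.
Import numFieldNormedType.Exports.
Import Order.TTheory GRing.Theory Num.Theory.
Local Open Scope classical_set_scope.
Local Open Scope ring_scope.

Set Implicit Arguments.
Unset Strict Implicit.

(** If [a < 0], then [t = 1] forces [b > 0], and for [t = min(1, -a / (2b))] the quadratic term is
    at most [-t * a / 2], so the sum is negative. *)
Lemma ge0_first_order (R : realFieldType) (a b : R) :
  (forall t, 0 < t <= 1 -> 0 <= t * a + t ^+ 2 * b) -> 0 <= a.
Proof.
move=> h; rewrite leNgt; apply/negP => a0.
have b0 : 0 < b by have := h 1; lra.
pose t := Num.min 1 (- a / (2 * b)).
have t0 : 0 < t by rewrite lt_min ltr01 divr_gt0//; lra.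
have tb : t * (2 * b) <= - a.
  by rewrite -ler_pdivlMr ?ge_min ?lexx ?orbT//; lra.
have /h : 0 < t <= 1 by rewrite t0 ge_min lexx.
by rewrite expr2; nra.
Qed.

(** The squared positive part is continuously differentiable, with derivative [2 * max a 0] and
    curvature at most 2; hence this quadratic upper bound. *)
Lemma sqr_max0D_le (R : realDomainType) (a h : R) :
  Num.max (a + h) 0 ^+ 2 <=
  Num.max a 0 ^+ 2 + 2 * Num.max a 0 * h + h ^+ 2.
Proof.
by case: (leP (a + h) 0) => ?; case: (leP a 0) => ?; nra.
Qed.

Lemma convex_set_segment (R : numDomainType) (V : lmodType R) (X : set V)
    (x y : V) (t : R) :
  convex_set X -> X x -> X y -> 0 <= t <= 1 -> X (t *: x + (1 - t) *: y).
Proof.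
move=> cvxX Xx Xy /andP[t0 t1].
by have /set_mem := cvxX x y (Itv01 t0 t1) (mem_set Xx) (mem_set Xy).
Qed.

(* At a minimizer [x0] over [X] of the sum of the squared positive parts of the
   [g i], the weights [max (g i x0) 0] work, by the first-order condition. *)
Lemma finite_minimax (R : realType) (V : normedModType R) (X : set V) (n : nat)
    (g : nat -> V -> R) :
  X !=set0 -> convex_set X -> compact X ->
  (forall i, continuous (g i)) ->
  (forall i x y t,
    g i (t *: x + (1 - t) *: y) = t * g i x + (1 - t) * g i y) ->
  (forall x, X x -> exists2 i, (i < n)%N & 0 < g i x) ->
  exists w : nat -> {nonneg R}, \sum_(i < n) (w i)%:num = 1 /\
    exists2 c, 0 < c & forall x, X x -> c <= \sum_(i < n) (w i)%:num * g i x.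
Proof.
move=> X0 cvxX cX gc gaff gpos.
pose phi x := \sum_(i < n) Num.max (g i x) 0 ^+ 2.
have phic : continuous phi.
  apply: continuous_big => [|i _ x]; first exact: add_continuous.
  apply: (@continuous_comp _ _ _
    (fun x => Num.max (g i x) 0) (fun u => u ^+ 2)).
    apply: continuous_max; [exact: gc|exact: cvg_cst].
  exact: exprn_continuous.
have [x0 /set_mem Xx0 x0min] := compact_EVT_min X0 cX
  (continuous_subspaceT phic).
pose p i := Num.max (g i x0) 0.
have p0 i : 0 <= p i by rewrite le_max lexx orbT.
have S0 : 0 < \sum_(i < n) p i.
  have [i ltin gi] := gpos _ Xx0.
  rewrite (bigD1 (Ordinal ltin))//= ltr_pwDl ?lt_max ?gi//.
  exact: sumr_ge0.
have phi0 : 0 < phi x0.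
  have [i ltin gi] := gpos _ Xx0.
  rewrite /phi (bigD1 (Ordinal ltin))//= ltr_pwDl ?exprn_gt0 ?lt_max ?gi//.
  by apply: sumr_ge0 => j _; exact: sqr_ge0.
set S := \sum_(i < n) p i in S0.
have wp i : 0 <= p i / S by rewrite divr_ge0// ltW.
exists (fun i => NngNum (wp i)); split => /=.
  by rewrite -mulr_suml divff// gt_eqF.
(* This is the value of the weighted combination at [x0], since [p i * g i x0 = p i ^+ 2]. It
   remains to see that the combination is minimal over [X] at [x0]. *)
exists (phi x0 / S); first exact: divr_gt0.
move=> x Xx.
under eq_bigr do rewrite mulrAC.
rewrite -mulr_suml ler_pM2r ?invr_gt0//.
rewrite -subr_ge0 -sumrB.
have -> : \sum_(i < n) (p i * g i x - Num.max (g i x0) 0 ^+ 2) =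
          \sum_(i < n) p i * (g i x - g i x0).
  apply: eq_bigr => i _; rewrite -/(p i) mulrBr; congr (_ - _).
  rewrite /p; case: leP => ?; first by rewrite mul0r expr2 mul0r.
  by rewrite expr2.
set A := \sum_(i < n) _.
suff : 0 <= 2 * A by rewrite pmulr_rge0.
(* Moving from [x0] towards [x] by a fraction [t] raises [phi] by at most [t * (2 * A)] plus
   [t ^+ 2] times this sum, and by at least 0 by minimality. *)
apply: (@ge0_first_order _ _ (\sum_(i < n) (g i x - g i x0) ^+ 2)).
move=> t /andP[t0 t1].
have t01 : 0 <= t <= 1 by rewrite ltW.
have := x0min _ (mem_set (convex_set_segment cvxX Xx Xx0 t01)).
rewrite -subr_ge0 => /le_trans; apply.
rewrite lerBlDl mulr_sumr mulr_sumr mulr_sumr -!big_split/=.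
apply: ler_sum => i _.
have -> : g i (t *: x + (1 - t) *: x0) = g i x0 + t * (g i x - g i x0).
  by rewrite gaff; ring.
apply: (le_trans (sqr_max0D_le _ _)); rewrite -/(p i).
by rewrite le_eqVlt; apply/orP; left; apply/eqP; ring.
Qed.

Lemma msum_dirac d (T : measurableType d) (R : realType) (n : nat)
    (w : nat -> {nonneg R}) (y : nat -> T) (A : set T) :
  msum (fun i => mscale (w i) \d_(y i)) n A =
  (\sum_(i < n) (w i)%:num * \1_A (y i))%:E.
Proof. by rewrite -sumEFin. Qed.

Lemma finite_probability d (T : measurableType d) (R : realType) (n : nat)
    (w : nat -> {nonneg R}) (y : nat -> T) :
  \sum_(i < n) (w i)%:num = 1 ->
  exists mu : probability T R,
    forall A, mu A = msum (fun i => mscale (w i) \d_(y i)) n A.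
Proof.
move=> w1.
pose m : {measure set T -> \bar R} := msum (fun i => mscale (w i) \d_(y i)) n.
have m1 : m setT = 1%E.
  rewrite [LHS]msum_dirac indicT.
  by under eq_bigr do rewrite mulr1; rewrite w1.
pose mu : probability T R :=
  HB.pack (Measure.sort m) (Measure_isProbability.Build _ _ _ m m1).
by exists mu.
Qed.

(** The formula is first proved for a measurable version [g] of [f], through its positive and
    negative parts, and then carried over to [f] atom by atom. *)
Lemma integral_finite_probability d (T : measurableType d) (R : realType)
    (n : nat) (w : nat -> {nonneg R}) (y : nat -> T) (mu : probability T R)
    (D : set T) (f : T -> R) :
  (forall A, mu A = msum (fun i => mscale (w i) \d_(y i)) n A) ->
  measurable D -> (forall i, (i < n)%N -> D (y i)) ->
  has_expectation mu D f ->
  (\int[mu]_(x in D) (f x)%:E = (\sum_(i < n) (w i)%:num * f (y i))%:E)%E.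
Proof.
move=> muE mD Dy [g ig fg].
rewrite (integral_version mD ig fg).
have mg : measurable_fun D (EFin \o g) by case/integrableP: ig.
have ge0E (h : T -> R) : (forall x, 0 <= h x) -> measurable_fun D (EFin \o h) ->
    (\int[mu]_(x in D) (h x)%:E = (\sum_(i < n) (w i)%:num * h (y i))%:E)%E.
  move=> h0 mh.
  rewrite (eq_measure_integral
    (msum (fun i => mscale (w i) \d_(y i)) n)); last first.
    by move=> A _ _; exact: muE.
  rewrite ge0_integral_measure_sum//; last by move=> x _; rewrite lee_fin.
  rewrite -sumEFin; apply: eq_bigr => i _.
  rewrite ge0_integral_mscale//; last by move=> x _; rewrite lee_fin.
  by rewrite integral_dirac//= diracE mem_set ?mul1e//; exact: Dy.
rewrite [LHS](integralE mu D (EFin \o g)) funerpos funerneg.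
rewrite !ge0E//; last 2 first.
- by rewrite -funerneg; exact: measurable_funeneg.
- by rewrite -funerpos; exact: measurable_funepos.
rewrite -EFinB -sumrB; congr EFin; apply: eq_bigr => i _.
rewrite -mulrBr; have -> : g^\+ (y i) - g^\- (y i) = g (y i).
  by rewrite -[in RHS](funrposBneg g).
(* A null set contains no atom of positive weight: either [w i] is 0 or [f] and [g] agree at
   [y i]. *)
have [N [mN N0 sN]] := fg.
have : mu N = 0%E by [].
rewrite muE msum_dirac => /eqP; rewrite eqe psumr_eq0 => [|j _]; last first.
  by rewrite mulr_ge0.
move=> /allP/(_ i (mem_index_enum i))/=; rewrite mulf_eq0 => /orP[/eqP->|].
  by rewrite !mul0r.
rewrite indicE pnatr_eq0 eqb0 => /negP yN; congr (_ * _).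
apply: contrapT => gfy; apply: yN; rewrite inE; apply: sN => /=.
by move=> /(_ (Dy _ (ltn_ord i)))/esym.
Qed.

Lemma dotvN (R : realType) d (u v : 'rV[R]_d) : dotv u (- v) = - dotv u v.
Proof.
by rewrite /dotv -sumrN; apply: eq_bigr => i _; rewrite !mxE mulrN.
Qed.

Lemma dotv_comb (R : realType) d (u v v' : 'rV[R]_d) (a b : R) :
  dotv u (a *: v + b *: v') = a * dotv u v + b * dotv u v'.
Proof.
rewrite /dotv !mulr_sumr -big_split; apply: eq_bigr => i _ /=.
by rewrite !mxE; ring.
Qed.

Lemma dotv_continuous (R : realType) d (u : 'rV[R]_d) : continuous (dotv u).
Proof.
apply: continuous_big => [|i _ v]; first exact: add_continuous.
by apply: continuousM; [exact: cst_continuous|exact: coord_continuous].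
Qed.

Unset Implicit Arguments.
Set Strict Implicit.

Theorem proposition3p7 (R : realType) (d : nat) (X : set 'rV[R]_d)
    (F : 'rV[R]_d -> 'rV[R]_d)
    (X0 : X !=set0) (cvxX : convex_set X) (cX : compact X) :
  minty X F <->
  ~ exists eps : R, exists mu : probability (borel_rV R d) R,
      eps < 0 /\ expected_VI_solution X F eps mu.
Proof.
split.
  move=> [x Xx xm] [eps [mu [eps0 [_ /(_ _ Xx) h]]]].
  have : (0 < \int[mu]_(y in X) (dotv (F y) (x - y))%:E)%E.
    by apply: lt_le_trans h; rewrite lte_fin oppr_gt0.
  apply/negP; rewrite -leNgt.
  have -> : (\int[mu]_(y in X) (dotv (F y) (x - y))%:E =
             \int[mu]_(y in X) - (dotv (F y) (y - x))%:E)%E.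
    by apply: eq_integral => y _; rewrite -EFinN -dotvN opprB.
  rewrite integral_ge0N; last by move=> y Xy; rewrite lee_fin; exact: xm.
  by rewrite oppe_le0; apply: integral_ge0 => y Xy; rewrite lee_fin; exact: xm.
move=> nsol; apply: contrapT => nminty.
pose g (y x : 'rV[R]_d) := dotv (F y) (x - y).
have gc y : continuous (g y).
  move=> x.
  have : {for x, continuous (dotv (F y) \o (fun x : 'rV[R]_d => x - y))}.
    apply: continuous_comp; last exact: dotv_continuous.
    by apply: continuousB; [exact: cvg_id|exact: cst_continuous].
  exact.
have gaff y u v t : g y (t *: u + (1 - t) *: v) = t * g y u + (1 - t) * g y v.
  rewrite /g -dotv_comb; congr dotv.
  by rewrite !scalerBr addrACA -opprD -scalerDl (addrC t) subrK scale1r.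
have [D DX Dcov] : finite_subset_cover X (fun y => [set x | 0 < g y x]) X.
  move: (cX); rewrite compact_cover; apply.
    move=> y _; exact: (continuousP _).1 (gc y) _ (@open_gt R 0).
  (* A point of [X] outside all the half-spaces would be a Minty point. *)
  move=> x Xx; apply: contrapT => ncov; apply: nminty; exists x => // y Xy.
  rewrite leNgt; apply/negP => gy; apply: ncov; exists y => //=.
  by rewrite /g -opprB dotvN oppr_gt0.
(* For [i >= n] the default 0 may lie outside [X]. This is harmless: [g (y i)] is continuous and
   affine for any [y i], and the sums stop before [n]. *)
pose n := size (enum_fset D); pose y i := nth 0 (enum_fset D) i.
have Xy i : (i < n)%N -> X (y i).
  by move=> ltin; apply/set_mem/DX; rewrite -/(y i); exact: mem_nth.
have gpos x : X x -> exists2 i, (i < n)%N & 0 < g (y i) x.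
  move=> /Dcov[z /= Dz gz]; exists (index z (enum_fset D)).
    by rewrite index_mem.
  by rewrite /y nth_index.
have [w [w1 [c c0 wc]]] := finite_minimax X0 cvxX cX
  (fun i => gc (y i)) (fun i => gaff (y i)) gpos.
have [mu muE] := @finite_probability _ (borel_rV R d) _ _ _ y w1.
have mX := compact_measurable_rV cX.
have muA (A : set (borel_rV R d)) :
    (forall i, (i < n)%N -> A (y i)) -> mu A = 1%E.
  move=> Ay; rewrite muE msum_dirac; apply: etrans (congr1 EFin w1).
  congr EFin; apply: eq_bigr => i _.
  by rewrite indicE mem_set ?mulr1//; exact: Ay.
(* [F] is arbitrary, so membership of [mu] in [Delta] rests on its finite support [D]. *)
have hE f : has_expectation mu X f.
  apply: (finite_support_has_expectation _ mX (finite_fset D)).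
  by apply: muA => i ltin; exact: mem_nth.
apply: nsol; exists (- c), mu; split; first by rewrite oppr_lt0.
split; first by split; [exact: muA|move=> x Xx; exact: hE].
move=> x Xx; rewrite opprK.
by rewrite (integral_finite_probability muE mX Xy)// lee_fin wc.
Qed.
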